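(* Let $a<b$ be real numbers and let $f:(a,b)\to\mathbb{R}$ have a power series expansion $$f(x)=\sum_{k=0}^{\infty}c_k(x-a)^k\qquad\text{for every }x\in(a,b),$$ where $\{c_k\}_{k\in\mathbb{N}_0}$ is a sequence of real coefficients only finitely many of which are negative; let $J=\{j_0,\ldots,j_\ell\}$ be the set of indices of the negative coefficients. Assume that the limit $f(b-)$ exists and is finite. Define $$F(x)=f(x)-\sum_{i=0}^{\ell}c_{j_i}(x-a)^{j_i}=\sum_{k\in\mathbb{N}_0\setminus J}c_k(x-a)^k,\qquad x\in(a,b),$$ and define the sequence $\{C_k\}_{k\in\mathbb{N}_0}$ of non-negative coefficients by $C_k=c_k$ if $c_k>0$ and $C_k=0$ if $c_k\le 0$. Then $$F(x)=\sum_{k=0}^{\infty}C_k(x-a)^k\qquad\text{for every }x\in(a,b).$$ Moreover, for every positive integer $n$, $F^{(k)}(a+)=k!\,C_k$ for $k\in\{0,1,\ldots,n\}$, and for every $x\in(a,b)$ the following inequalities hold: $$\sum_{k=0}^{n-1}C_k(x-a)^k+\frac{1}{(b-a)^n}\left(F(b-)-\sum_{k=0}^{n-1}(b-a)^kC_k\right)(x-a)^n>F(x)>\sum_{k=0}^{n}C_k(x-a)^k,$$ i.e. $$\sum_{k=0}^{n-1}C_k(x-a)^k+\sum_{i=0}^{\ell}c_{j_i}(x-a)^{j_i}+\frac{(x-a)^n}{(b-a)^n}\left(f(b-)-\sum_{k=0}^{n-1}C_k(b-a)^k-\sum_{i=0}^{\ell}c_{j_i}(b-a)^{j_i}\ri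ght)>f(x)>\sum_{k=0}^{n}C_k(x-a)^k+\sum_{i=0}^{\ell}c_{j_i}(x-a)^{j_i}.$$
   Context: $\mathbb{N}_0=\{0,1,2,\ldots\}$. For a function $g$ on $(a,b)$, $g(b-)=\lim_{x\to b^-}g(x)$, and $g^{(k)}(a+)=\lim_{x\to a^+}g^{(k)}(x)$ is the one-sided limit of the $k$-th derivative (with $g^{(0)}=g$).
   Formalization: The strict inequalities fail when no C_m with m > n is positive (e.g. f = 0, or a polynomial f with n at least its degree); they are proved strictly whenever some such C_m is positive, and in non-strict form for every positive n. *)

(* Defs.v *)
From Stdlib Require Import Reals List Arith.
From Coquelicot Require Import Coquelicot.
Open Scope R_scope.

Definition pos_coef (c : nat -> R) (k : nat) : R :=
  if Rlt_dec 0 (c k) then c k else 0.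

(* A list with repetitions would count terms several times: J is meant to be
   duplicate-free. *)
Definition sum_over (J : list nat) (c : nat -> R) (a x : R) : R :=
  fold_right Rplus 0 (map (fun j => c j * (x - a) ^ j) J).

Definition coef_outside (J : list nat) (c : nat -> R) (k : nat) : R :=
  if in_dec Nat.eq_dec k J then 0 else c k.

(* sum_n u N has the N+1 terms u 0, ..., u N, so the sum over k <= n - 1
   is taken at pred n; it is only used for n >= 1. *)
Definition psum (c : nat -> R) (a x : R) (N : nat) : R :=
  sum_n (fun k => c k * (x - a) ^ k) N.

(* Main.v *)
Require Import Defs.
From Stdlib Require Import Reals List Arith Lra Lia.
From Coquelicot Require Import Coquelicot.
Open Scope R_scope.

(** Removing the finitely many negative terms from the expansion of [f] leaves
    the expansion of [F], whose coefficients are exactly [C k >= 0]. Taking out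
    the terms of index below [n] gives
    [F x = sum_(k < n) C k (x - a)^k + (x - a)^n G x], where
    [G x = sum_k C (n + k) (x - a)^k] is again a power series with non-negative
    coefficients ([is_pseries_tail]), hence non-decreasing in [x]
    ([pseries_gap]). Both inequalities compare [G x] with its values at the two
    ends of the interval. At [a] this value is the constant term [C n], which
    yields the lower bound. At [b] it is
    [(F(b-) - sum_(k < n) C k (b - a)^k) / (b - a)^n], by the very formula that
    defines [G] from [F], so that the limit of [F] at
    [b-] determines that of [G] ([pseries_tail_le_limit]); this yields the upper
    bound. If some [C m] with [m > n] is positive then [G] is strictly
    increasing, and both bounds are strict. The bounds for [f] are those for [F]
    shifted by the finite sum.

    The derivatives at [a+] come from the fact that the radius of convergence
    is at least [b - a > 0], so that the [k]-th derivative of [F] is the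
    continuous function given by termwise differentiation, whose constant term
    is [k! C k]. *)

(** * Finite sums of monomials *)

Lemma sum_Sn_R (u : nat -> R) (n : nat) :
  sum_n u (S n) = sum_n u n + u (S n) :> R.
Proof. exact (sum_Sn u n). Qed.

Lemma is_pseries_monomial (v y : R) (j : nat) :
  is_pseries (fun k => if Nat.eq_dec k j then v else 0) y (v * y ^ j).
Proof.
  apply is_pseries_R.
  apply filterlim_ext_loc with (f := fun _ : nat => v * y ^ j);
    [ | apply filterlim_const].
  exists j; intros N hN; symmetry.
  assert (partial : forall N, sum_n (fun k =>
      (if Nat.eq_dec k j then v else 0) * y ^ k) N
      = (if le_dec j N then v * y ^ j else 0) :> R).
  { clear N hN; induction N as [|N IH].
    - rewrite sum_O.
      destruct (Nat.eq_dec 0 j) as [<-|ne]; destruct (le_dec _ 0); try lia; ring.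
    - rewrite sum_Sn_R, IH.
      destruct (Nat.eq_dec (S N) j) as [<-|ne];
        destruct (le_dec _ N); destruct (le_dec _ (S N)); try lia; simpl; ring. }
  rewrite partial; destruct (le_dec j N); [reflexivity | lia].
Qed.

(** A repeated index would count twice in [sum_over] but once in the
    coefficients, hence the hypothesis on [J]. *)
Lemma is_pseries_sum_over (c : nat -> R) (a x : R) (J : list nat) :
  NoDup J ->
  is_pseries (fun k => if in_dec Nat.eq_dec k J then c k else 0) (x - a)
    (sum_over J c a x).
Proof.
  induction 1 as [|j J hj _ IH].
  - apply is_pseries_ext with (fun k => if Nat.eq_dec k 0 then 0 else 0).
    { intros k; simpl; now destruct (Nat.eq_dec k 0). }
    replace (sum_over nil c a x) with (0 * (x - a) ^ 0)
      by (unfold sum_over; simpl; ring).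
    apply is_pseries_monomial.
  - apply is_pseries_ext with
      (PS_plus (fun k => if Nat.eq_dec k j then c j else 0)
               (fun k => if in_dec Nat.eq_dec k J then c k else 0)).
    + intros k; unfold PS_plus; match goal with |- plus ?u ?v = ?w => change (u + v = w) end.
      destruct (Nat.eq_dec k j) as [->|ne];
        destruct (in_dec Nat.eq_dec _ J) as [i|i];
        destruct (in_dec Nat.eq_dec _ (j :: J)) as [i'|i'];
        simpl in *; try tauto; try ring.
      destruct i' as [e|i']; [now elim ne | tauto].
    + apply (is_pseries_plus _ _ _ _ _ (is_pseries_monomial (c j) (x - a) j) IH).
Qed.

Lemma continuous_sum_over (J : list nat) (c : nat -> R) (a x : R) :
  continuous (sum_over J c a) x.
Proof.
  unfold sum_over; induction J as [|j J IH]; simpl.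
  - apply continuous_const.
  - apply (continuous_plus (fun x => c j * (x - a) ^ j)); [|exact IH].
    apply (ex_derive_continuous (fun x => c j * (x - a) ^ j)); auto_derive; easy.
Qed.

Lemma continuous_psum (c : nat -> R) (a x : R) (n : nat) :
  continuous (fun x => psum c a x n) x.
Proof.
  unfold psum; induction n as [|n IH].
  - apply continuous_ext with (fun x => c O * (x - a) ^ 0).
    { intros z; now rewrite sum_O. }
    apply (ex_derive_continuous (fun x => c O * (x - a) ^ 0)); auto_derive; easy.
  - apply continuous_ext with (fun x =>
      plus (sum_n (fun k => c k * (x - a) ^ k) n) (c (S n) * (x - a) ^ S n)).
    { intros z; now rewrite sum_Sn_R. }
    apply (continuous_plus (fun x => sum_n (fun k => c k * (x - a) ^ k) n));
      [exact IH|].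
    apply (ex_derive_continuous (fun x => c (S n) * (x - a) ^ S n)); auto_derive; easy.
Qed.

Lemma filterlim_within_continuous (g : R -> R) (D : R -> Prop) (x : R) :
  continuous g x -> filterlim g (within D (locally x)) (locally (g x)).
Proof.
  intros hg; apply filterlim_filter_le_1 with (2 := hg), filter_le_within.
Qed.

(** * Power series with non-negative coefficients *)

Lemma pos_coef_nonneg (c : nat -> R) (k : nat) : 0 <= pos_coef c k.
Proof. unfold pos_coef; destruct (Rlt_dec 0 (c k)); lra. Qed.

Lemma coef_outside_negatives (c : nat -> R) (J : list nat) (k : nat) :
  (forall k, In k J <-> c k < 0) -> coef_outside J c k = pos_coef c k.
Proof.
  intros hJ; specialize (hJ k); unfold coef_outside, pos_coef.
  destruct (in_dec Nat.eq_dec k J) as [i|i]; destruct (Rlt_dec 0 (c k)); auto.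
  - apply hJ in i; lra.
  - destruct (Rlt_dec (c k) 0) as [l|l]; [tauto | lra].
Qed.

Lemma is_series_ge_term (u : nat -> R) (l : R) :
  (forall k, 0 <= u k) -> is_series u l -> forall m, u m <= l.
Proof.
  intros pos hl m.
  apply Rle_trans with (sum_n u m).
  - assert (nonneg : forall n, 0 <= sum_n u n).
    { induction n as [|n IH]; [rewrite sum_O; apply pos|].
      rewrite sum_Sn_R; specialize (pos (S n)); lra. }
    destruct m as [|m]; [rewrite sum_O; lra|].
    rewrite sum_Sn_R; specialize (nonneg m); lra.
  - apply is_lim_seq_incr_compare; [exact hl|].
    intros n; rewrite sum_Sn_R; specialize (pos (S n)); lra.
Qed.

(** The difference of two values is [sum_k D k (z^k - y^k)], a series of
    non-negative terms, hence at least any one of them. The term [m = 0] is zero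
    and gives monotonicity; a term [m > 0] with [D m > 0] gives strictness. *)
Lemma pseries_gap (D : nat -> R) (y z s t : R) :
  (forall k, 0 <= D k) -> 0 <= y <= z ->
  is_pseries D y s -> is_pseries D z t ->
  forall m, D m * (z ^ m - y ^ m) <= t - s.
Proof.
  intros pos hyz hs ht m.
  apply is_pseries_R in hs; apply is_pseries_R in ht.
  apply (is_series_ge_term (fun k => D k * (z ^ k - y ^ k))).
  - intros k; apply Rmult_le_pos; [apply pos|].
    assert (y ^ k <= z ^ k) by (apply pow_incr; lra); lra.
  - apply is_series_ext with
      (fun k => plus (D k * z ^ k) (opp (D k * y ^ k))).
    { intros k; unfold plus, opp; simpl; ring. }
    exact (is_series_minus _ _ _ _ ht hs).
Qed.

Lemma pseries_incr (D : nat -> R) (y z s t : R) :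
  (forall k, 0 <= D k) -> 0 <= y <= z ->
  is_pseries D y s -> is_pseries D z t -> s <= t.
Proof.
  intros pos hyz hs ht.
  assert (h := pseries_gap D y z s t pos hyz hs ht O); simpl in h; lra.
Qed.

Lemma pow_lt_compat (y z : R) (m : nat) :
  0 <= y < z -> (0 < m)%nat -> y ^ m < z ^ m.
Proof.
  intros hyz hm; destruct m as [|m]; [lia|]; clear hm.
  simpl; assert (y ^ m <= z ^ m) by (apply pow_incr; lra).
  assert (0 < z ^ m) by (apply pow_lt; lra).
  apply Rle_lt_trans with (y * z ^ m).
  - apply Rmult_le_compat_l; lra.
  - apply Rmult_lt_compat_r; lra.
Qed.

Lemma pseries_strict_incr (D : nat -> R) (y z s t : R) (m : nat) :
  (forall k, 0 <= D k) -> (0 < m)%nat -> 0 < D m -> 0 <= y < z ->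
  is_pseries D y s -> is_pseries D z t -> s < t.
Proof.
  intros pos hm hDm hyz hs ht.
  assert (hyz' : 0 <= y <= z) by lra.
  assert (h := pseries_gap D y z s t pos hyz' hs ht m).
  assert (p := pow_lt_compat y z m hyz hm).
  assert (0 < D m * (z ^ m - y ^ m)) by (apply Rmult_lt_0_compat; lra); lra.
Qed.

(** The left end of the comparison: it makes the leading coefficient a value of
    the tail series, so that one monotonicity statement serves both bounds. *)
Lemma is_pseries_at_0 (D : nat -> R) : is_pseries D 0 (D O).
Proof.
  apply is_pseries_R.
  apply is_series_ext with
    (fun k => (if Nat.eq_dec k 0 then D O else 0) * 0 ^ k).
  - intros k; destruct (Nat.eq_dec k 0) as [->|ne]; [easy|].
    rewrite pow_ne_zero by exact ne; simpl; ring.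
  - assert (h := is_pseries_monomial (D O) 0 0).
    apply is_pseries_R in h; simpl in h; rewrite Rmult_1_r in h; exact h.
Qed.

(** The general term of a convergent series tends to 0, which fails outside the
    disk of convergence. *)
Lemma CV_radius_ge_conv (D : nat -> R) (y s : R) :
  is_pseries D y s -> Rbar_le (Rabs y) (CV_radius D).
Proof.
  intros hs; apply Rbar_not_lt_le; intros lt.
  apply (CV_disk_outside D y lt).
  apply ex_series_lim_0; exists s; apply is_pseries_R, hs.
Qed.

(** * Tails *)

(** Expressing the sum of the shifted series through [s] is what lets a limit of
    the function be transferred to a limit of its tail. *)
Lemma is_pseries_tail (C : nat -> R) (a x s : R) (n : nat) :
  a < x -> (1 <= n)%nat -> is_pseries C (x - a) s ->
  is_pseries (fun k => C (n + k)%nat) (x - a)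
    ((s - psum C a x (pred n)) / (x - a) ^ n).
Proof.
  intros hx hn hs.
  assert (inv : mult (/ (x - a)) (x - a) = one)
    by (unfold mult, one; simpl; field; lra).
  assert (h := is_pseries_decr_n C n (x - a) (/ (x - a)) s inv hn hs).
  replace ((s - psum C a x (pred n)) / (x - a) ^ n) with
    (scal (pow_n (/ (x - a)) n)
       (plus s (opp (sum_n (fun k => scal (pow_n (x - a) k) (C k)) (n - 1))))).
  { exact h. }
  unfold psum; rewrite <- Nat.sub_1_r.
  rewrite (sum_n_ext _ (fun k => C k * (x - a) ^ k)).
  - rewrite pow_n_pow, pow_inv; unfold scal, plus, opp; simpl.
    unfold mult; simpl; field; apply pow_nonzero; lra.
  - intros k; rewrite pow_n_pow; unfold scal; simpl; unfold mult; simpl; ring.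
Qed.

(** * Functions given by a power series to the right of its centre *)

(** Convergence at the midpoint of [x] and [b] puts [x] strictly inside the disk.
    The value [x = a] is included, since the derivatives are to be continuous
    up to the centre. *)
Lemma CV_radius_gt_right (a b : R) (F : R -> R) (C : nat -> R) :
  (forall x, a < x < b -> is_pseries C (x - a) (F x)) ->
  forall x, a <= x < b -> Rbar_lt (Rabs (x - a)) (CV_radius C).
Proof.
  intros hF x hx.
  apply Rbar_lt_le_trans with (Rabs ((x + b) / 2 - a)).
  - simpl; rewrite !Rabs_pos_eq; lra.
  - apply CV_radius_ge_conv with (F ((x + b) / 2)); apply hF; lra.
Qed.

Lemma locally_eq_PSeries (a b : R) (F : R -> R) (C : nat -> R) :
  (forall x, a < x < b -> is_pseries C (x - a) (F x)) ->
  forall x, a < x < b -> locally x (fun t => PSeries C (t + - a) = F t).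
Proof.
  intros hF x hx.
  apply (filter_imp (fun t => a < t < b)).
  - intros t ht; apply is_pseries_unique, hF, ht.
  - apply filter_and; [apply (open_gt a) | apply (open_lt b)]; lra.
Qed.

Lemma pseries_ex_derive_n_right (a b : R) (F : R -> R) (C : nat -> R) (k : nat) :
  (forall x, a < x < b -> is_pseries C (x - a) (F x)) ->
  forall x, a < x < b -> ex_derive_n F k x.
Proof.
  intros hF x hx.
  apply ex_derive_n_ext_loc with (1 := locally_eq_PSeries a b F C hF x hx).
  apply (ex_derive_n_comp_trans (PSeries C) k x (- a)).
  apply ex_derive_n_PSeries.
  apply (CV_radius_gt_right a b F C hF); lra.
Qed.

(** The function [F] is constrained only to the right of [a], so its derivatives
    are replaced there by those of the power series, which is smooth on a full
    neighbourhood of its centre. *)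
Lemma pseries_Derive_n_at_right (a b : R) (F : R -> R) (C : nat -> R) (k : nat) :
  a < b ->
  (forall x, a < x < b -> is_pseries C (x - a) (F x)) ->
  filterlim (Derive_n F k) (at_right a) (locally (INR (fact k) * C k)).
Proof.
  intros hab hF.
  assert (radius := CV_radius_gt_right a b F C hF).
  apply filterlim_ext_loc with (fun x => PSeries (PS_derive_n k C) (x - a)).
  - assert (d : 0 < b - a) by lra.
    exists (mkposreal _ d); intros x hx xa; apply Rabs_lt_between' in hx; simpl in hx.
    assert (hx' : a < x < b) by lra.
    apply eq_trans with (Derive_n (fun t => PSeries C (t + - a)) k x).
    + rewrite (Derive_n_comp_trans (PSeries C) k x (- a)).
      symmetry; apply Derive_n_PSeries, radius; lra.
    + exact (Derive_n_ext_loc _ _ k x (locally_eq_PSeries a b F C hF x hx')).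
  - replace (INR (fact k) * C k) with (PSeries (PS_derive_n k C) (a - a)).
    + apply (filterlim_within_continuous (fun x => PSeries (PS_derive_n k C) (x - a))
               (fun u => a < u)).
      apply (continuous_comp (fun x => x - a) (PSeries (PS_derive_n k C))).
      * apply (ex_derive_continuous (fun x => x - a)); auto_derive; easy.
      * apply continuity_pt_filterlim, PSeries_continuity.
        rewrite CV_radius_derive_n; apply radius; lra.
    + rewrite Rminus_diag, PSeries_0; unfold PS_derive_n; simpl; field.
Qed.

(** * Taylor polynomial bounds *)

(** The tail on the left is non-decreasing in [x], so it is at most its limit at
    [b-], which is read off from the limit of [F]. *)
Lemma pseries_tail_le_limit (a b Fb : R) (F : R -> R) (C : nat -> R) (n : nat) (x : R) :
  (forall k, 0 <= C k) -> (1 <= n)%nat ->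
  (forall x, a < x < b -> is_pseries C (x - a) (F x)) ->
  filterlim F (at_left b) (locally Fb) -> a < x < b ->
  (F x - psum C a x (pred n)) / (x - a) ^ n
    <= (Fb - psum C a b (pred n)) / (b - a) ^ n.
Proof.
  intros pos hn hF hFb hx.
  set (G := fun t => (F t - psum C a t (pred n)) / (t - a) ^ n).
  apply (filterlim_le (F := at_left b) (fun _ => G x) G (G x)
           ((Fb - psum C a b (pred n)) / (b - a) ^ n)).
  - assert (d : 0 < b - x) by lra.
    exists (mkposreal _ d); intros t ht tb; apply Rabs_lt_between' in ht; simpl in ht.
    apply (pseries_incr (fun k => C (n + k)%nat) (x - a) (t - a)).
    + intros k; apply pos.
    + lra.
    + apply is_pseries_tail; [lra | exact hn | apply hF; lra].
    + apply is_pseries_tail; [lra | exact hn | apply hF; lra].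
  - apply filterlim_const.
  - apply (filterlim_comp_2 (G := locally (Fb - psum C a b (pred n)))
             (H := locally (/ (b - a) ^ n))
             (fun t => F t - psum C a t (pred n)) (fun t => / (t - a) ^ n) Rmult).
    + apply (filterlim_comp_2 (G := locally Fb)
               (H := locally (- psum C a b (pred n)))
               F (fun t => - psum C a t (pred n)) Rplus);
        [exact hFb | | exact (filterlim_plus Fb (- psum C a b (pred n)))].
      apply (filterlim_within_continuous (fun t => - psum C a t (pred n)) (fun u => u < b)).
      apply (continuous_opp (fun t => psum C a t (pred n))), continuous_psum.
    + apply (filterlim_within_continuous (fun t => / (t - a) ^ n) (fun u => u < b)).
      apply (ex_derive_continuous (fun t => / (t - a) ^ n)); auto_derive.
      apply pow_nonzero; lra.
    + exact (filterlim_mult (Fb - psum C a b (pred n)) (/ (b - a) ^ n)).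
Qed.

Lemma pseries_taylor_bounds (a b Fb : R) (F : R -> R) (C : nat -> R) (n : nat) (x : R) :
  (forall k, 0 <= C k) -> (1 <= n)%nat ->
  (forall x, a < x < b -> is_pseries C (x - a) (F x)) ->
  filterlim F (at_left b) (locally Fb) -> a < x < b ->
  let upper := psum C a x (pred n)
    + 1 / (b - a) ^ n * (Fb - psum C a b (pred n)) * (x - a) ^ n in
  (psum C a x n <= F x <= upper) /\
  ((exists m, (n < m)%nat /\ 0 < C m) -> psum C a x n < F x < upper).
Proof.
  intros pos hn hF hFb hx upper.
  set (G := fun t => (F t - psum C a t (pred n)) / (t - a) ^ n).
  set (L := (Fb - psum C a b (pred n)) / (b - a) ^ n).
  assert (xn : 0 < (x - a) ^ n) by (apply pow_lt; lra).
  assert (bn : 0 < (b - a) ^ n) by (apply pow_lt; lra).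
  assert (tail : forall t, a < t < b ->
            is_pseries (fun k => C (n + k)%nat) (t - a) (G t))
    by (intros t ht; apply is_pseries_tail; [lra | exact hn | apply hF; lra]).
  assert (tail0 : is_pseries (fun k => C (n + k)%nat) 0 (C n)).
  { assert (h := is_pseries_at_0 (fun k => C (n + k)%nat)); simpl in h.
    rewrite Nat.add_0_r in h; exact h. }
  assert (nonneg : forall k, 0 <= C (n + k)%nat) by (intros k; apply pos).
  assert (limit : forall t, a < t < b -> G t <= L)
    by (intros t ht; exact (pseries_tail_le_limit a b Fb F C n t pos hn hF hFb ht)).
  assert (Fx : F x = psum C a x (pred n) + G x * (x - a) ^ n)
    by (unfold G; field; lra).
  assert (low : psum C a x n = psum C a x (pred n) + C n * (x - a) ^ n).
  { destruct n as [|n']; [lia|]; apply (sum_Sn_R (fun k => C k * (x - a) ^ k)). }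
  assert (up : upper = psum C a x (pred n) + L * (x - a) ^ n)
    by (unfold upper, L; field; lra).
  rewrite Fx, low, up; split.
  - split; apply Rplus_le_compat_l, Rmult_le_compat_r; try lra.
    + apply (pseries_incr _ 0 (x - a) _ _ nonneg); [lra | exact tail0 | auto].
    + auto.
  - intros [m [hnm hm]].
    assert (hm' : 0 < C (n + (m - n))%nat)
      by (replace (n + (m - n))%nat with m by lia; exact hm).
    assert (hmn : (0 < m - n)%nat) by lia.
    split; apply Rplus_lt_compat_l, Rmult_lt_compat_r; try lra.
    + apply (pseries_strict_incr _ 0 (x - a) _ _ (m - n) nonneg hmn hm');
        [lra | exact tail0 | auto].
    (* The limit at b is not a value of the series, so strictness is gained
       between [x] and an intermediate point. *)
    + apply Rlt_le_trans with (G ((x + b) / 2)); [|apply limit; lra].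
      apply (pseries_strict_incr _ (x - a) ((x + b) / 2 - a) _ _ (m - n) nonneg hmn hm');
        [lra | apply tail; lra | apply tail; lra].
Qed.

Theorem theorem1 (a b : R) (hab : a < b) (f : R -> R) (c : nat -> R)
  (hf : forall x : R, a < x < b -> is_pseries c (x - a) (f x))
  (J : list nat) (hJnodup : NoDup J) (hJ : forall k : nat, In k J <-> c k < 0)
  (fb : R) (hfb : filterlim f (at_left b) (locally fb)) :
  let F := fun x : R => f x - sum_over J c a x in
  let C := pos_coef c in
  (forall x : R, a < x < b -> is_pseries (coef_outside J c) (x - a) (F x)) /\
  (forall x : R, a < x < b -> is_pseries C (x - a) (F x)) /\
  exists Fb : R, filterlim F (at_left b) (locally Fb) /\
    forall n : nat, (1 <= n)%nat ->
      (forall k : nat, (k <= n)%nat ->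
        (forall x : R, a < x < b -> ex_derive_n F k x) /\
        filterlim (Derive_n F k) (at_right a) (locally (INR (fact k) * C k))) /\
      (forall x : R, a < x < b ->
        let upperF := psum C a x (pred n)
          + 1 / (b - a) ^ n * (Fb - psum C a b (pred n)) * (x - a) ^ n in
        let lowerF := psum C a x n in
        let upperf := psum C a x (pred n) + sum_over J c a x
          + (x - a) ^ n / (b - a) ^ n
            * (fb - psum C a b (pred n) - sum_over J c a b) in
        let lowerf := psum C a x n + sum_over J c a x in
        (upperF >= F x /\ F x >= lowerF /\
         upperf >= f x /\ f x >= lowerf) /\
        ((exists m : nat, (n < m)%nat /\ 0 < C m) ->
         upperF > F x /\ F x > lowerF /\
         upperf > f x /\ f x > lowerf)).
Proof.
  intros F C.
  assert (outside : forall x, a < x < b ->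
            is_pseries (coef_outside J c) (x - a) (F x)).
  { intros x hx.
    apply is_pseries_ext with
      (PS_minus c (fun k => if in_dec Nat.eq_dec k J then c k else 0)).
    - intros k; unfold PS_minus, PS_plus, PS_opp, coef_outside.
      match goal with |- plus ?u (opp ?v) = ?w => change (u + - v = w) end.
      destruct (in_dec Nat.eq_dec k J); ring.
    - exact (is_pseries_minus _ _ _ _ _ (hf x hx)
               (is_pseries_sum_over c a x J hJnodup)). }
  assert (hF : forall x, a < x < b -> is_pseries C (x - a) (F x)).
  { intros x hx; apply is_pseries_ext with (2 := outside x hx).
    intros k; apply (coef_outside_negatives c J k hJ). }
  assert (hFb : filterlim F (at_left b) (locally (fb - sum_over J c a b))).
  { apply (filterlim_comp_2 (G := locally fb) (H := locally (- sum_over J c a b))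
             f (fun t => - sum_over J c a t) Rplus);
      [exact hfb | | exact (filterlim_plus fb (- sum_over J c a b))].
    apply (filterlim_within_continuous (fun t => - sum_over J c a t) (fun u => u < b)).
    apply (continuous_opp (sum_over J c a)), continuous_sum_over. }
  split; [exact outside|]; split; [exact hF|].
  exists (fb - sum_over J c a b); split; [exact hFb|].
  intros n hn; split.
  - intros k _; split.
    + exact (pseries_ex_derive_n_right a b F C k hF).
    + exact (pseries_Derive_n_at_right a b F C k hab hF).
  - intros x hx upperF lowerF upperf lowerf.
    assert (bn : 0 < (b - a) ^ n) by (apply pow_lt; lra).
    destruct (pseries_taylor_bounds a b _ F C n x (pos_coef_nonneg c) hn hF hFb hx)
      as [weak strict].
    fold upperF in weak, strict; fold lowerF in weak, strict.
    assert (fx : f x = F x + sum_over J c a x) by (unfold F; ring).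
    assert (up : upperf = upperF + sum_over J c a x)
      by (unfold upperf, upperF; field; lra).
    assert (low : lowerf = lowerF + sum_over J c a x) by reflexivity.
    rewrite up, low, fx; split.
    + repeat split; lra.
    + intros hm; specialize (strict hm); repeat split; lra.
Qed.
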